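(* Let $g\ge 1$ and $n\ge 1$. The group $P_{g,n}$ is the iterated (internal) semi-direct product $$P_{g,n} = \overline{V}_{g,1} \rtimes \bigl(\overline{V}_{g,2} \rtimes ( \cdots \rtimes (\overline{V}_{g,g} \rtimes \widetilde{P}_n) \cdots )\bigr).$$
   Context: For $m\ge 2$, $B_m$ is the Artin braid group on $m$ strings with generators $\sigma_1,\dots,\sigma_{m-1}$ and relations $\sigma_i\sigma_j=\sigma_j\sigma_i$ for $|i-j|>1$, $\sigma_i\sigma_{i+1}\sigma_i=\sigma_{i+1}\sigma_i\sigma_{i+1}$ for $1\le i\le m-2$. For $1\le i<j\le m$ put $a_{ij}=\sigma_{j-1}\sigma_{j-2}\cdots\sigma_{i+1}\sigma_i^2\sigma_{i+1}^{-1}\cdots\sigma_{j-2}^{-1}\sigma_{j-1}^{-1}$; these generate the pure braid group $P_m$. The braid group $B_{g,n}$ on $n$ strings in the handlebody of genus $g$ is the group with generators $\tau_1,\dots,\tau_g,\sigma_{g+1},\dots,\sigma_{g+n-1}$ and relations: $\sigma_i\sigma_j=\sigma_j\sigma_i$ for $|i-j|>1$; $\sigma_i\sigma_{i+1}\sigma_i=\sigma_{i+1}\sigma_i\sigma_{i+1}$ for $g+1\le i\le g+n-2$; $\tau_k\sigma_i=\sigma_i\tau_k$ for $1\le k\le g$, $i\ge g+2$; $\tau_k(\sigma_{g+1}\tau_k\sigma_{g+1})=(\sigma_{g+1}\tau_k\sigma_{g+1})\tau_k$ for $1\le k\le g$; $\tau_k(\sigma_{g+1}^{-1}\tau_{k+l}\sigma_{g+1})=(\sigma_{g+1}^{-1}\tau_{k+l}\sigma_{g+1})\tau_k$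 for $1\le k\le g-1$, $1\le l\le g-k$. It is identified with the subgroup of $B_{g+n}$ generated by $\tau_k=a_{k,g+1}$ ($1\le k\le g$) and $\sigma_{g+1},\dots,\sigma_{g+n-1}$ (braids leaving the first $g$ strings unbraided); all $a_{ij}$ below are taken in $B_{g+n}$. $P_{g,n}$ is the kernel of the epimorphism $\psi_n:B_{g,n}\to S_n$, $\tau_k\mapsto 1$, $\sigma_i\mapsto (i,i+1)$ (with $S_n$ acting on $\{g+1,\dots,g+n\}$). $\widetilde{B}_n=\langle\sigma_{g+1},\dots,\sigma_{g+n-1}\rangle\cong B_n$, and $\widetilde{P}_n=\langle a_{ij} : g+1\le i<j\le g+n\rangle\cong P_n$ is its pure braid group. For $1\le i\le g$, $V_{g,i}=\langle a_{i,g+1},a_{i,g+2},\dots,a_{i,g+n}\rangle$, and $\overline{V}_{g,i}$ is the normal closure of $V_{g,i}$ in the subgroup $\langle V_{g,i},V_{g,i+1},\dots,V_{g,g},\widetilde{P}_n\rangle$. In a semi-direct product $A\rtimes B$ the factor $A$ is the normal one. *)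

(* Defs.v *)
(* Libraries: MathComp; mathcomp-classical supplies quotients by non-decidable
   relations and subsets of infinite groups. *)
From HB Require Import structures.
From mathcomp Require Import all_boot fingroup perm.
From mathcomp Require Import boolp classical_sets zify.

Set Implicit Arguments.
Unset Strict Implicit.
Unset Printing Implicit Defensive.

Local Open Scope classical_set_scope.
Local Open Scope group_scope.

(* fingroup shadows the representative function of quotient types. *)
Local Notation qrepr := generic_quotient.repr.

Section Subgroups.
Variable G : groupType.
Implicit Types A B C : set G.

Definition is_subgroup A : Prop :=
  [/\ A 1, forall x y, A x -> A y -> A (x * y) & forall x, A x -> A x^-1].

Definition is_normal_subgroup A B : Prop :=
  [/\ is_subgroup A, A `<=` B & forall x b, A x -> B b -> A (b * x * b^-1)].

Definition gen_subgroup A : set G := smallest is_subgroup A.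

(* The normal closure of A in B, for A included in the subgroup B. *)
Definition normal_closure A B : set G :=
  smallest (fun N => is_normal_subgroup N B) A.

(* C = A \rtimes B, the factor A being the normal one *)
Definition is_sdprod A B C : Prop :=
  [/\ is_subgroup C, is_normal_subgroup A C, is_subgroup B /\ B `<=` C,
      A `&` B = [set 1] & C = [set a * b | a in A & b in B]].

(* C = A_1 \rtimes (A_2 \rtimes ( ... \rtimes (A_k \rtimes B) ... )) for
   As = [:: A_1; ...; A_k]. *)
Fixpoint is_iter_sdprod (As : seq (set G)) B C : Prop :=
  if As is A :: As' then
    exists2 D, is_iter_sdprod As' B D & is_sdprod A D C
  else is_subgroup B /\ C = B.

End Subgroups.

Section Presentation.
Variable X : choiceType.

(* (x, false) stands for the letter x, (x, true) for its inverse. *)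
Definition word : choiceType := seq (X * bool).

Definition pos (x : X) : word := [:: (x, false)].
Definition neg (x : X) : word := [:: (x, true)].

Definition inv_word (w : word) : word := rev [seq (p.1, ~~ p.2) | p <- w].

(* The congruence on words generated by free reduction and R. *)
Inductive word_cong (R : word -> word -> Prop) : word -> word -> Prop :=
| WordRefl u : word_cong R u u
| WordSym u v : word_cong R u v -> word_cong R v u
| WordTrans v u w : word_cong R u v -> word_cong R v w -> word_cong R u w
| WordCat u u' v v' :
    word_cong R u u' -> word_cong R v v' -> word_cong R (u ++ v) (u' ++ v')
| WordCancel x b : word_cong R [:: (x, b); (x, ~~ b)] [::]
| WordRel u v : R u v -> word_cong R u v.

Section Group.
Variable R : word -> word -> Prop.

Definition word_congb : rel word := fun u v => `[< word_cong R u v >].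

Fact word_congb_refl : reflexive word_congb.
Proof. by move=> u; apply/asboolP; apply: WordRefl. Qed.

Fact word_congb_sym : symmetric word_congb.
Proof. by move=> u v; apply/asboolP/asboolP; apply: WordSym. Qed.

Fact word_congb_trans : transitive word_congb.
Proof.
by move=> v u w /asboolP uv /asboolP vw; apply/asboolP; apply: WordTrans uv vw.
Qed.

Canonical word_cong_equiv :=
  EquivRel word_congb word_congb_refl word_congb_sym word_congb_trans.

(* The group <X | u = v for all u, v with R u v>. *)
Definition presented : Type := {eq_quot word_congb}%qT.

HB.instance Definition _ := Choice.on presented.
HB.instance Definition _ := EqQuotient.on presented.

Definition presented_class (u : word) : presented := (\pi_presented u)%qT.

Lemma presented_classP u v :
  presented_class u = presented_class v <-> word_cong R u v.
Proof.
split=> [/eqP | uv].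
  by rewrite /presented_class piE => /asboolP.
by apply/eqP; rewrite /presented_class piE; apply/asboolP.
Qed.

Lemma repr_presented_class u : word_cong R (qrepr (presented_class u)) u.
Proof. by apply/presented_classP; rewrite /presented_class reprK. Qed.

Let pone : presented := presented_class [::].
Let pmul (x y : presented) : presented := presented_class (qrepr x ++ qrepr y).
Let pinv (x : presented) : presented := presented_class (inv_word (qrepr x)).

Let pmulE u v :
  pmul (presented_class u) (presented_class v) = presented_class (u ++ v).
Proof. by apply/presented_classP/WordCat; apply: repr_presented_class. Qed.

Let presentedP (x : presented) : exists u, x = presented_class u.
Proof. by exists (qrepr x); rewrite /presented_class reprK. Qed.

Lemma word_cong_invl u : word_cong R (inv_word u ++ u) [::].
Proof.
elim: u => [|[x b] u IHu]; first exact: WordRefl.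
rewrite /inv_word /= rev_cons -/(inv_word u) cat_rcons.
apply: WordTrans IHu; apply: WordCat; first exact: WordRefl.
rewrite -[_ :: _]/([:: (x, ~~ b); (x, b)] ++ u) -[X in word_cong _ _ X]cat0s.
apply: WordCat; last exact: WordRefl.
by rewrite -[in (x, b)](negbK b); apply: WordCancel.
Qed.

Lemma inv_wordK : involutive inv_word.
Proof.
move=> u; rewrite /inv_word map_rev revK -map_comp map_id_in // => -[x b] _ /=.
by rewrite negbK.
Qed.

Let pmulA : associative pmul.
Proof.
move=> x y z; have [u ->] := presentedP x; have [v ->] := presentedP y.
by have [w ->] := presentedP z; rewrite !pmulE catA.
Qed.

Let pmul1 : left_id pone pmul.
Proof. by move=> x; have [u ->] := presentedP x; rewrite pmulE. Qed.

Let p1mul : right_id pone pmul.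
Proof. by move=> x; have [u ->] := presentedP x; rewrite pmulE cats0. Qed.

Let pmulV : left_inverse pone pinv pmul.
Proof.
move=> x; rewrite -{2}[x]reprK pmulE.
exact/presented_classP/word_cong_invl.
Qed.

Let pVmul : right_inverse pone pinv pmul.
Proof.
move=> x; rewrite -{1}[x]reprK pmulE; apply/presented_classP.
by rewrite -{1}[qrepr x]inv_wordK; apply: word_cong_invl.
Qed.

HB.instance Definition _ :=
  isGroup.Build presented pmulA pmul1 p1mul pmulV pVmul.

Definition presented_gen (x : X) : presented := presented_class (pos x).

Lemma presented_classM u v :
  presented_class (u ++ v) = presented_class u * presented_class v.
Proof. by rewrite -pmulE. Qed.

Lemma presented_class0 : presented_class [::] = 1.
Proof. by []. Qed.

Lemma presented_classV x : presented_class (neg x) = (presented_gen x)^-1.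
Proof.
apply: (can_inj (mulgK (presented_gen x))); rewrite mulVg -presented_classM.
exact/presented_classP/WordCancel.
Qed.

End Group.

Section Lift.
Variables (H : groupType) (f : X -> H).

Definition eval_word (w : word) : H :=
  \prod_(p <- w) (if p.2 then (f p.1)^-1 else f p.1).

Definition respects (R : word -> word -> Prop) : Prop :=
  forall u v, R u v -> eval_word u = eval_word v.

Lemma eval_word_cat u v : eval_word (u ++ v) = eval_word u * eval_word v.
Proof. by rewrite /eval_word big_cat. Qed.

Lemma eval_pos x : eval_word (pos x) = f x.
Proof. by rewrite /eval_word big_seq1. Qed.

Lemma eval_neg x : eval_word (neg x) = (f x)^-1.
Proof. by rewrite /eval_word big_seq1. Qed.

Variables (R : word -> word -> Prop) (fR : respects R).

(* The homomorphism presented R -> H extending f. *)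
Definition presented_lift of respects R :=
  fun x : presented R => eval_word (qrepr x).

Lemma eval_word_cong u v : word_cong R u v -> eval_word u = eval_word v.
Proof.
elim=> // [v' u' w _ -> _ -> //|u1 u2 v1 v2 _ Eu _ Ev|x b].
  by rewrite !eval_word_cat Eu Ev.
by rewrite /eval_word !big_cons big_nil; case: b; rewrite /= ?mulgA mulg1
  ?(mulVg, mulgV).
Qed.

Lemma presented_lift_class u :
  presented_lift fR (presented_class R u) = eval_word u.
Proof. exact: eval_word_cong (repr_presented_class _ _). Qed.

Lemma presented_liftE x : presented_lift fR (presented_gen R x) = f x.
Proof. by rewrite presented_lift_class eval_pos. Qed.

Fact presented_lift_monoid_morphism : monoid_morphism (presented_lift fR).
Proof.
split=> [|x y]; first by rewrite presented_lift_class /eval_word big_nil.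
rewrite -[x]reprK -[y]reprK -[LHS]/(presented_lift fR
  (presented_class R (qrepr x) * presented_class R (qrepr y))).
by rewrite -presented_classM !presented_lift_class eval_word_cat.
Qed.

HB.instance Definition _ :=
  isUMagmaMorphism.Build (presented R) H (presented_lift fR)
    presented_lift_monoid_morphism.

End Lift.

Lemma presented_classE R u :
  presented_class R u = eval_word (presented_gen R) u.
Proof.
elim: u => [|[x b] u IHu]; first by rewrite /eval_word big_nil.
rewrite -cat1s presented_classM IHu eval_word_cat; congr (_ * _).
by case: b; rewrite ?eval_neg ?eval_pos // -presented_classV.
Qed.

Lemma presented_rel R u v : R u v ->
  eval_word (presented_gen R) u = eval_word (presented_gen R) v.
Proof.
by move=> Ruv; rewrite -!presented_classE; apply/presented_classP/WordRel.
Qed.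

End Presentation.

Definition braid_gen (m : nat) : choiceType := {k : nat | 0 < k < m}%N.

Inductive braid_rel (m : nat) : word (braid_gen m) -> word (braid_gen m) -> Prop :=
| BraidFar (i j : braid_gen m) of
    ((val i).+1 < val j)%N || ((val j).+1 < val i)%N :
    braid_rel (pos i ++ pos j) (pos j ++ pos i)
| BraidNext (i j : braid_gen m) of val j = (val i).+1 :
    braid_rel (pos i ++ pos j ++ pos i) (pos j ++ pos i ++ pos j).

Definition braid (m : nat) : groupType := presented (@braid_rel m).

(* sigma m k is the generator \sigma_k of B_m if 1 <= k < m (1 otherwise). *)
Definition sigma (m k : nat) : braid m :=
  oapp (presented_gen (@braid_rel m)) 1 (insub k).

(* \sigma_{j-1} \sigma_{j-2} ... \sigma_{i+1} *)
Definition sigma_down (m i j : nat) : braid m :=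
  \prod_(k <- rev (iota i.+1 (j - i.+1))) sigma m k.

(* a_{ij} = \sigma_{j-1} ... \sigma_{i+1} \sigma_i^2
   \sigma_{i+1}^-1 ... \sigma_{j-1}^-1, for 1 <= i < j <= m *)
Definition pure_gen (m i j : nat) : braid m :=
  sigma_down m i j * sigma m i ^+ 2 * (sigma_down m i j)^-1.

(* inl k is \tau_k and inr i is \sigma_i. *)
Definition hbraid_gen (g n : nat) : choiceType :=
  ({k : nat | 0 < k <= g}%N + {i : nat | g < i < g + n}%N)%type.

Definition tauw g n (k : {k : nat | 0 < k <= g}%N) : word (hbraid_gen g n) :=
  pos (inl k : hbraid_gen g n).
Definition sigw g n (i : {i : nat | g < i < g + n}%N) : word (hbraid_gen g n) :=
  pos (inr i : hbraid_gen g n).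
Definition sigVw g n (i : {i : nat | g < i < g + n}%N) : word (hbraid_gen g n) :=
  neg (inr i : hbraid_gen g n).

Inductive hbraid_rel (g n : nat) :
    word (hbraid_gen g n) -> word (hbraid_gen g n) -> Prop :=
| HBraidFar (i j : {i : nat | g < i < g + n}%N) of
    ((val i).+1 < val j)%N || ((val j).+1 < val i)%N :
    hbraid_rel (sigw i ++ sigw j) (sigw j ++ sigw i)
| HBraidNext (i j : {i : nat | g < i < g + n}%N) of val j = (val i).+1 :
    hbraid_rel (sigw i ++ sigw j ++ sigw i) (sigw j ++ sigw i ++ sigw j)
| HBraidTauSigma (k : {k : nat | 0 < k <= g}%N)
    (i : {i : nat | g < i < g + n}%N) of (g + 2 <= val i)%N :
    hbraid_rel (tauw n k ++ sigw i) (sigw i ++ tauw n k)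
| HBraidTau (k : {k : nat | 0 < k <= g}%N)
    (s : {i : nat | g < i < g + n}%N) of val s = g.+1 :
    hbraid_rel (tauw n k ++ (sigw s ++ tauw n k ++ sigw s))
               ((sigw s ++ tauw n k ++ sigw s) ++ tauw n k)
| HBraidTauTau (k l : {k : nat | 0 < k <= g}%N)
    (s : {i : nat | g < i < g + n}%N) of (val k < val l)%N & val s = g.+1 :
    hbraid_rel (tauw n k ++ (sigVw s ++ tauw n l ++ sigw s))
               ((sigVw s ++ tauw n l ++ sigw s) ++ tauw n k).

Definition hbraid (g n : nat) : groupType := presented (@hbraid_rel g n).

Section Tperm.
Variable T : finType.
Implicit Types a b c d : T.

Lemma tperm_far a b c d : uniq [:: a; b; c; d] ->
  tperm a b * tperm c d = tperm c d * tperm a b.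
Proof.
rewrite /= !inE !negb_or => /and4P[/and3P[ab ac ad] /andP[bc bd] cd _].
by apply/commgP/conjg_fixP; rewrite tpermJ !tpermD // eq_sym.
Qed.

Lemma tperm_braid a b c : uniq [:: a; b; c] ->
  tperm a b * (tperm b c * tperm a b) = tperm b c * (tperm a b * tperm b c).
Proof.
rewrite /= !inE !negb_or => /and3P[/andP[ab ac] bc _].
have E1 : tperm b c ^ tperm a b = tperm a c.
  by rewrite tpermJ tpermR tpermD // eq_sym.
have E2 : tperm a b ^ tperm b c = tperm a c.
  by rewrite tpermJ tpermL tpermD // eq_sym.
move: E1 E2; rewrite !conjgE !tpermV => -> ->; done.
Qed.
End Tperm.

(* \sigma_i acts on {g+1, ..., g+n}, encoded as 'I_n via p |-> p - (g+1). *)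
Section Psi.
Variables g n : nat.

Fact hsig_lo (i : {i : nat | g < i < g + n}%N) : (val i - g.+1 < n)%N.
Proof. by case: i => i /= /andP[gi ign]; rewrite ltn_subLR // ltnW. Qed.

Fact hsig_hi (i : {i : nat | g < i < g + n}%N) : (val i - g < n)%N.
Proof. by case: i => i /= /andP[gi ign]; rewrite ltn_subLR // ltnW. Qed.

Definition psi_gen (x : hbraid_gen g n) : {perm 'I_n} :=
  match x with
  | inl _ => 1
  | inr i => tperm (Ordinal (hsig_lo i)) (Ordinal (hsig_hi i))
  end.

Fact psi_respects : respects psi_gen (@hbraid_rel g n).
Proof.
move=> u v [i j far|i j next|k i _|k s _|k l s _ _];
  rewrite !eval_word_cat ?eval_pos ?eval_neg /= ?mul1g ?mulg1 //; last first.
- have hl : Ordinal (hsig_hi i) = Ordinal (hsig_lo j).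
    by apply: val_inj; rewrite /= next subSS.
  rewrite hl; apply: tperm_braid; rewrite /= !inE -!val_eqE /= next.
  by have := valP i; rewrite /=; lia.
apply: tperm_far; rewrite /= !inE -!val_eqE /=.
by have := valP i; have := valP j; move: far; rewrite /=; lia.
Qed.

Definition psi : hbraid g n -> {perm 'I_n} := presented_lift psi_respects.

Lemma psi_tau k : psi (presented_gen _ (inl k)) = 1.
Proof. exact: presented_liftE. Qed.

Lemma psi_sigma i : psi (presented_gen _ (inr i)) =
  tperm (Ordinal (hsig_lo i)) (Ordinal (hsig_hi i)).
Proof. exact: presented_liftE. Qed.

Definition hpure : set (hbraid g n) := [set x | psi x = 1].

End Psi.

Arguments hpure g n : clear implicits.

Section BraidRelations.
Variable m : nat.
Notation s := (sigma m).
Notation a := (pure_gen m).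

Lemma sigma_gen (i : braid_gen m) : s (val i) = presented_gen _ i.
Proof. by rewrite /sigma valK. Qed.

Lemma sigma_far i j : (i.+1 < j)%N -> commute (s i) (s j).
Proof.
rewrite /sigma => ij; case: insubP => [x _ xi|_] /=; last exact/commute_sym/commute1.
case: insubP => [y _ yj|_] /=; last exact: commute1.
have /presented_rel : braid_rel (pos x ++ pos y) (pos y ++ pos x).
  by apply: BraidFar; rewrite xi yj ij.
by rewrite !eval_word_cat !eval_pos.
Qed.

Lemma sigma_braid i : (0 < i)%N -> (i.+1 < m)%N ->
  s i * (s i.+1 * s i) = s i.+1 * (s i * s i.+1).
Proof.
move=> i0 im; have hi : (0 < i < m)%N by rewrite i0 ltnW.
have hj : (0 < i.+1 < m)%N by rewrite im.
pose x : braid_gen m := exist _ i hi; pose y : braid_gen m := exist _ i.+1 hj.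
have /presented_rel : braid_rel (pos x ++ pos y ++ pos x)
  (pos y ++ pos x ++ pos y) by apply: BraidNext.
by rewrite !eval_word_cat !eval_pos -!sigma_gen.
Qed.

Lemma pure_gen_base i : a i i.+1 = s i ^+ 2.
Proof. by rewrite /pure_gen /sigma_down subnn /= big_nil mul1g invg1 mulg1. Qed.

Lemma pure_genS i j : (i < j)%N -> a i j.+1 = s j * a i j * (s j)^-1.
Proof.
move=> ij; rewrite /pure_gen /sigma_down subSn //.
rewrite -[(j - _).+1]addn1 iotaD rev_cat subnKC //= big_cons.
by rewrite invgM !mulgA.
Qed.

Lemma sigma_pure_far i j k : (i < j)%N -> (j < k)%N -> commute (a i j) (s k).
Proof.
move=> ij jk; elim: j ij jk => // j IHj ij jk.
have /commute_sym sk : commute (s j) (s k) by apply: sigma_far.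
have [->|ij'] := eqVneq i j.
  by rewrite pure_gen_base; apply/commute_sym/commuteX; apply/sk.
have {}ij : (i < j)%N by lia.
rewrite pure_genS //; apply/commute_sym.
apply/commuteM; last exact/commuteV.
by apply/commuteM => //; apply/commute_sym/IHj => //; lia.
Qed.

End BraidRelations.

Section BraidIdentities.
Variables (G : groupType) (x y : G).
Hypothesis xy : x * (y * x) = y * (x * y).
Implicit Types A B z : G.

Let xyz z : x * (y * (x * z)) = y * (x * (y * z)).
Proof. by have := congr1 (fun t => t * z) xy; rewrite -!mulgA. Qed.

Let e1 z : x^-1 * (y * (x * z)) = y * (x * (y^-1 * z)).
Proof. by apply: (mulgI x); rewrite mulVKg xyz mulVKg. Qed.

Let e2 z : y^-1 * (x * (y * z)) = x * (y * (x^-1 * z)).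
Proof. by apply: (mulgI y); rewrite mulVKg -xyz mulVKg. Qed.

Let e3 : y^-1 * (x^-1 * y) = x * (y^-1 * x^-1).
Proof.
apply: (mulgI y); apply: (mulgI x).
by rewrite mulVKg [RHS]xyz !mulVKg mulgV mulg1.
Qed.

Lemma braid_four_base : commute (x ^+ 2) (y * (x ^+ 2 * y)).
Proof.
rewrite /commute !expgS !expg0 !mulg1 -!mulgA.
by rewrite [in LHS]xyz [in LHS]xyz [in RHS]xyz xy.
Qed.

Lemma braid_four_step A : commute A y -> commute A (x * (A * x)) ->
  commute (x * A * x^-1) (y * (x * A * x^-1 * y)).
Proof.
move=> Ay AxAx; have Ayz z : A * (y * z) = y * (A * z) by rewrite !mulgA Ay.
have AVz z : y^-1 * (A * z) = A * (y^-1 * z).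
  by apply: (mulgI y); rewrite -Ayz !mulVKg.
have AxAxz z : A * (x * (A * (x * z))) = x * (A * (x * (A * z))).
  by have := congr1 (fun t => t * z) AxAx; rewrite -!mulgA.
by rewrite /commute -!mulgA !e1 !AVz e3 !Ayz AxAxz -xyz.
Qed.

Let e4 : x^-1 * y = y * (x * (y^-1 * x^-1)).
Proof. by have := e1 x^-1; rewrite mulgV mulg1. Qed.

Let commute_conj A B : commute A B -> commute (x * A * x^-1) (x * B * x^-1).
Proof. by rewrite /commute -!mulgA !mulKg => AB; congr (_ * _); rewrite !mulgA AB. Qed.

Lemma braid_five_base A : commute A y ->
  commute (x * A * x^-1) (y^-1 * (x ^+ 2 * y)).
Proof.
move=> Ay.
have -> : y^-1 * (x ^+ 2 * y) = x * (y ^+ 2) * x^-1.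
  rewrite !expgS !expg0 !mulg1; apply: (canRL (mulgK x)); rewrite -!mulgA.
  by rewrite xy e2 mulKg.
exact/commute_conj/commuteX.
Qed.

Lemma braid_five_step A B : commute A y -> commute B y ->
  commute A (x^-1 * (B * x)) ->
  commute (x * A * x^-1) (y^-1 * (x * B * x^-1 * y)).
Proof.
move=> Ay By AB.
have -> : y^-1 * (x * B * x^-1 * y) =
    x * (y * ((x^-1 * (B * x)) * y^-1)) * x^-1.
  by rewrite -!mulgA e4 [B * (y * _)]mulgA By -!mulgA e2.
apply: commute_conj; apply: commuteM => //.
by apply: commuteM => //; apply: commuteV.
Qed.

End BraidIdentities.

Section PureRelations.
Variable m : nat.
Notation s := (sigma m).
Notation a := (pure_gen m).

Lemma pure_four i j : (0 < i)%N -> (i < j)%N -> (j < m)%N ->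
  commute (a i j) (s j * (a i j * s j)).
Proof.
move=> i0; elim: j => // j IHj ij jm.
have [<-|ij'] := eqVneq i j.
  by rewrite pure_gen_base; apply: braid_four_base; apply: sigma_braid => //; lia.
have {}ij : (i < j)%N by lia.
rewrite pure_genS //; apply: braid_four_step; first by apply: sigma_braid; lia.
  exact: sigma_pure_far.
by apply: IHj; lia.
Qed.

Lemma pure_five k l j : (0 < k)%N -> (k < l)%N -> (l < j)%N -> (j < m)%N ->
  commute (a k j) ((s j)^-1 * (a l j * s j)).
Proof.
move=> k0 kl; elim: j => // j IHj lj jm.
rewrite (@pure_genS m k j); last by lia.
have [<-|lj'] := eqVneq l j.
  rewrite pure_gen_base; apply: braid_five_base; first by apply: sigma_braid; lia.
  exact: sigma_pure_far.
have {}lj : (l < j)%N by lia.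
rewrite pure_genS //; apply: braid_five_step.
- by apply: sigma_braid; lia.
- by apply: sigma_pure_far; lia.
- exact: sigma_pure_far.
by apply: IHj; lia.
Qed.

End PureRelations.

Section HandlebodyToBraid.
Variables g n : nat.

Definition hbraid_to_braid_gen (x : hbraid_gen g n) : braid (g + n) :=
  match x with
  | inl k => pure_gen (g + n) (val k) g.+1
  | inr i => sigma (g + n) (val i)
  end.

Fact hbraid_to_braid_respects :
  respects hbraid_to_braid_gen (@hbraid_rel g n).
Proof.
move=> u v [i j far|i j next|k i gi|k s sg|k l s kl sg];
  rewrite !eval_word_cat ?eval_pos ?eval_neg /=.
- by case/orP: far => ?; [|apply: esym]; apply: sigma_far.
- by case: i j next => i hi [j hj] /= E; rewrite E in hj *; apply: sigma_braid; lia.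
- by case: k i gi => k hk [i hi] /= gi; apply: sigma_pure_far; lia.
- by case: k s sg => k hk [s hs] /= E; rewrite E in hs *; apply: pure_four; lia.
case: k l s kl sg => k hk [l hl] [s hs] /= kl E.
by rewrite E in hs *; apply: pure_five; lia.
Qed.

(* The canonical map along which B_{g,n} is identified with the subgroup
   <a_{1,g+1}, ..., a_{g,g+1}, \sigma_{g+1}, ..., \sigma_{g+n-1}> of B_{g+n};
   its image is that subgroup. *)
Definition hbraid_to_braid : hbraid g n -> braid (g + n) :=
  presented_lift hbraid_to_braid_respects.

Lemma hbraid_to_braid_tau k :
  hbraid_to_braid (presented_gen _ (inl k)) = pure_gen (g + n) (val k) g.+1.
Proof. exact: presented_liftE. Qed.

Lemma hbraid_to_braid_sigma i :
  hbraid_to_braid (presented_gen _ (inr i)) = sigma (g + n) (val i).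
Proof. exact: presented_liftE. Qed.

(* The pure handlebody braid group P_{g,n} = ker psi_n, as a subgroup of
   B_{g+n}. *)
Definition Pgn : set (braid (g + n)) := hbraid_to_braid @` hpure g n.

Definition Pn_tilde : set (braid (g + n)) :=
  gen_subgroup
    [set pure_gen (g + n) p.1 p.2 | p in
      [set p : nat * nat | [&& g < p.1, p.1 < p.2 & p.2 <= g + n]%N]].

Definition V (i : nat) : set (braid (g + n)) :=
  gen_subgroup [set pure_gen (g + n) i j | j in [set j | g < j <= g + n]%N].

(* \overline{V}_{g,i}, the normal closure of V_{g,i} in
   <V_{g,i}, ..., V_{g,g}, Pn_tilde> *)
Definition V_bar (i : nat) : set (braid (g + n)) :=
  normal_closure (V i)
    (gen_subgroup (\bigcup_(k in [set k | i <= k <= g]%N) V k `|` Pn_tilde)).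

End HandlebodyToBraid.

Arguments Pgn g n : clear implicits.
Arguments Pn_tilde g n : clear implicits.
Arguments V g n i : clear implicits.
Arguments V_bar g n i : clear implicits.

(* Main.v *)
(* Write H_i = <V_{g,i}, ..., V_{g,g}, P~_n>.  Deleting the strand which starts
   at position i and inserting a trivial strand on the left is a homomorphism
   on the braids whose strand i ends at i.  It kills a_{ij} for j > i and fixes
   sigma_k for k > i, hence it is trivial on the normal closure of V_{g,i} and
   the identity on H_{i+1}, so that these two subgroups of H_i meet trivially;
   their product is H_i because they generate it and the first one is normal.
   Finally H_1 contains the sigma_k^2 and is normalized by the sigma_k with
   k > g, so every element of the image of B_{g,n} is an element of H_1 times a
   product of braids sigma_{t} ... sigma_{i+1}, one for each position t+1 > g+1;
   these have to be trivial, one after the other, when the permutation is, so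
   H_1 is the image of the kernel of psi_n. *)
Require Import Defs.
From mathcomp Require Import all_boot fingroup perm.
From mathcomp Require Import boolp classical_sets zify.

Set Implicit Arguments.
Unset Strict Implicit.
Unset Printing Implicit Defensive.

Local Open Scope classical_set_scope.
Local Open Scope group_scope.

Local Notation qrepr := generic_quotient.repr.

(** * Generated subgroups, normal closures and internal semi-direct products *)

Section GeneratedSubgroups.
Variable G : groupType.
Implicit Types (A B C : set G) (x y : G).

Lemma gen_subgroupP A : is_subgroup (gen_subgroup A).
Proof.
split=> [M [[]] //|x y Ax Ay M AM|x Ax M AM]; have [[_ MM MV] _] := AM.
  exact: MM (Ax M AM) (Ay M AM).
exact: MV (Ax M AM).
Qed.

Lemma sub_gen_subgroup A : A `<=` gen_subgroup A.
Proof. exact: sub_smallest. Qed.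

Lemma gen_subgroup_sub A B : is_subgroup B -> A `<=` B -> gen_subgroup A `<=` B.
Proof. exact: smallest_sub. Qed.

(** The elements that preserve [B] by right multiplication, together with their inverses, form a
    subgroup even when [B] is a mere set; below, [B] is a product set or a union of cosets. *)
Lemma gen_subgroup_ind A B : B 1 ->
    (forall x a, B x -> A a -> B (x * a) /\ B (x * a^-1)) ->
  gen_subgroup A `<=` B.
Proof.
move=> B1 BA z Az.
pose C := [set z | forall x, B x -> B (x * z) /\ B (x * z^-1)].
suff: C z by move=> /(_ 1 B1)[]; rewrite mul1g.
apply: gen_subgroup_sub z Az; last by move=> a Aa x Bx; apply: BA.
split=> [x Bx|x y Cx Cy z Bz|x Cx y By]; first by rewrite invg1 mulg1.
  rewrite invgM !mulgA; split; first by have [/Cy[]] := Cx z Bz.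
  by have [_ /Cx[]] := Cy z Bz.
by rewrite invgK; have [] := Cx y By.
Qed.

Lemma is_subgroup_conj A x :
  is_subgroup A -> is_subgroup [set y | A (x * y * x^-1)].
Proof.
move=> [A1 AM AV]; split=> [|y z /= Ay Az|y /= Ay] /=.
- by rewrite mulg1 mulgV.
- have -> : x * (y * z) * x^-1 = (x * y * x^-1) * (x * z * x^-1).
    by rewrite !mulgA mulgKV.
  exact: AM.
- have -> : x * y^-1 * x^-1 = (x * y * x^-1)^-1 by rewrite !invgM invgK !mulgA.
  exact: AV.
Qed.

Lemma sub_normal_closure A B : A `<=` normal_closure A B.
Proof. exact: sub_smallest. Qed.

Lemma normal_closure_sub A B C :
  is_normal_subgroup C B -> A `<=` C -> normal_closure A B `<=` C.
Proof. by move=> nC AC x; apply. Qed.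

Lemma normal_closureP A B :
  is_subgroup B -> A `<=` B -> is_normal_subgroup (normal_closure A B) B.
Proof.
move=> gB AB; have [B1 BM BV] := gB; split.
- split=> [M [[[]]] //|x y Ax Ay M NM|x Ax M NM];
    have [[[_ MM MV] _ _] _] := NM.
    exact: MM (Ax M NM) (Ay M NM).
  exact: MV (Ax M NM).
- apply: normal_closure_sub => //; split=> // x b Bx Bb.
  exact: BM (BM _ _ Bb Bx) (BV _ Bb).
- move=> x b Ax Bb M NM; have [[_ _ MJ] _] := NM.
  exact: MJ (Ax M NM) Bb.
Qed.

(** Since $y a = (y a y^{-1}) y$ and [A] is normal, the product set of [A] and [B] is stable under
    right multiplication by both factors, so it contains the group they generate. *)
Lemma is_sdprod_gen A B C :
    is_normal_subgroup A C -> is_subgroup B -> is_subgroup C -> B `<=` C ->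
    C `<=` gen_subgroup (A `|` B) -> A `&` B `<=` [set 1] ->
  is_sdprod A B C.
Proof.
move=> nA gB gC BC CAB AB1; have [[A1 AM AV] AC AJ] := nA.
have [B1 BM BV] := gB; have [C1 CM CV] := gC; split=> //.
  by apply/seteqP; split=> // _ ->; split.
apply/seteqP; split=> [x /CAB|_ [a Aa [b Bb <-]]]; last first.
  by apply: CM; [apply: AC | apply: BC].
apply: gen_subgroup_ind x => [|_ a [x Ax [y By <-]] [Aa|Ba]].
- by exists 1 => //; exists 1 => //; rewrite mulg1.
- have J z : A z -> A (y * z * y^-1) by move=> Az; apply: AJ => //; apply: BC.
  split.
    exists (x * (y * a * y^-1)); first by apply: AM => //; apply: J.
    by exists y => //; rewrite !mulgA mulgKV.
  exists (x * (y * a^-1 * y^-1)); first by apply: AM => //; apply/J/AV.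
  by exists y => //; rewrite !mulgA mulgKV.
- split; exists x => //; rewrite -mulgA.
    by exists (y * a) => //; apply: BM.
  by exists (y * a^-1) => //; apply: BM => //; apply: BV.
Qed.

End GeneratedSubgroups.

(* Inner conditionals first: lia does not see through nested ones. *)
Ltac case_ifs := repeat match goal with |- context [if ?b then _ else _] =>
  lazymatch b with
  | context [if _ then _ else _] => fail
  | _ => destruct b eqn:?; try lia
  end end.

(** * Deletion of one strand of a braid *)

Section Strands.
Variable m : nat.
Notation s := (sigma m).
Notation a := (pure_gen m).
Notation D := (sigma_down m).
Notation B := (braid m).

Lemma sigma_down_id i j : (j <= i.+1)%N -> D i j = 1.
Proof. by rewrite -subn_eq0 /sigma_down => /eqP ->; rewrite big_nil. Qed.

Lemma sigma_downS i j : (i < j)%N -> D i j.+1 = s j * D i j.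
Proof.
move=> ij; rewrite /sigma_down subSn // -[(j - _).+1]addn1 iotaD rev_cat.
by rewrite subnKC //= big_cons.
Qed.

Lemma sigma_down_last i j : (i.+1 < j)%N -> D i j = D i.+1 j * s i.+1.
Proof.
move=> ij; rewrite /sigma_down -[(j - i.+1)%N]prednK ?subn_gt0 //= rev_cons.
rewrite -cats1 big_cat big_seq1 /=.
by congr (\prod_(k <- rev (iota _ _)) _ * _); lia.
Qed.

Definition swap k p : nat :=
  if p == k then k.+1 else if p == k.+1 then k else p.

(* The braid \sigma_k with its strand starting at position p deleted and
   replaced by a trivial strand to the left of all others; 1 if p > m. *)
Definition sigma_forget k p : B :=
  if (p < k)%N then s k else if (k.+1 < p <= m)%N then s k.+1 else 1.

(** The first component is the final position of the strand starting at [p], the second the braid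
    left after its deletion. For an inverse letter, this deletion is inverse to that of the strand
    starting at [q] in the letter itself. *)
Fixpoint strand_word (w : word (braid_gen m)) p : nat * B :=
  if w is (x, b) :: w' then
    let q := swap (val x) p in
    let r := strand_word w' q in
    (r.1, (if b then (sigma_forget (val x) q)^-1 else sigma_forget (val x) p)
          * r.2)
  else (p, 1).

Lemma swapK k : involutive (swap k).
Proof.
move=> p; rewrite /swap; case: (eqVneq p k) => [->|pk].
  by rewrite eqxx; case: eqP => //; lia.
case: (eqVneq p k.+1) => [->|pk1]; first by rewrite eqxx.
by rewrite (negPf pk) (negPf pk1).
Qed.

Lemma strand_word_cat u v p :
  strand_word (u ++ v) p =
    ((strand_word v (strand_word u p).1).1,
     (strand_word u p).2 * (strand_word v (strand_word u p).1).2).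
Proof.
elim: u p => [|[x b] u IHu] p /=; first by rewrite mul1g; case: strand_word.
by rewrite IHu /= mulgA.
Qed.

Lemma sigma_forget_far i j p : (i.+1 < j)%N -> (j < m)%N ->
  sigma_forget i p * sigma_forget j (swap i p) =
  sigma_forget j p * sigma_forget i (swap j p).
Proof.
move=> ij jm; rewrite /swap /sigma_forget; case_ifs; rewrite ?mulg1 ?mul1g //;
  apply: sigma_far; lia.
Qed.

Lemma swap_far i j p : (i.+1 < j)%N -> swap j (swap i p) = swap i (swap j p).
Proof. by move=> ij; rewrite /swap; case_ifs. Qed.

(** If [p] is one of the three positions involved, a single [s i.+1] remains on both sides. For
    [p < i] the relation is kept, for [i.+2 < p <= m] its indices rise by one, and beyond [m] both
    sides are trivial. *)
Lemma sigma_forget_braid i p : (0 < i)%N -> (i.+1 < m)%N ->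
  sigma_forget i p * (sigma_forget i.+1 (swap i p) *
    sigma_forget i (swap i.+1 (swap i p))) =
  sigma_forget i.+1 p * (sigma_forget i (swap i.+1 p) *
    sigma_forget i.+1 (swap i (swap i.+1 p))).
Proof.
move=> i0 im; rewrite /swap /sigma_forget; case_ifs; rewrite ?mulg1 ?mul1g //;
  apply: sigma_braid; lia.
Qed.

Lemma swap_braid i p :
  swap i (swap i.+1 (swap i p)) = swap i.+1 (swap i (swap i.+1 p)).
Proof. by rewrite /swap; case_ifs. Qed.

Lemma strand_word_cong u v :
  word_cong (@braid_rel m) u v -> strand_word u =1 strand_word v.
Proof.
elim=> {u v} [//|u v _ IH|v u w _ uv _ vw|u u' v v' _ uu' _ vv'|x b|u v uv] p.
- by rewrite IH.
- by rewrite uv vw.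
- by rewrite !strand_word_cat uu' vv'.
- rewrite /= swapK; case: b => /=; rewrite ?swapK mulg1 ?mulgV ?mulVg //.
case: uv => [i j far|i j next] /=; rewrite !mulg1.
  have /andP[_ im] := valP i; have /andP[_ jm] := valP j.
  case/orP: far => far; rewrite (swap_far _ far).
    by rewrite (sigma_forget_far _ far jm).
  by rewrite (sigma_forget_far _ far im).
have := valP i; have := valP j; rewrite next => /andP[_ jm] /andP[i0 _].
by rewrite next swap_braid sigma_forget_braid.
Qed.

Definition endpoint (x : B) p : nat := (strand_word (qrepr x) p).1.

(* Deletes the strand of x starting at position p and adds a trivial strand to
   the left of all others. *)
Definition forget p (x : B) : B := (strand_word (qrepr x) p).2.

Lemma strand_class u p :
  strand_word (qrepr (presented_class (@braid_rel m) u)) p = strand_word u p.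
Proof. exact/strand_word_cong/repr_presented_class. Qed.

Lemma strandM (x y : B) p :
  strand_word (qrepr (x * y)) p =
    (endpoint y (endpoint x p), forget p x * forget (endpoint x p) y).
Proof.
rewrite -[x in LHS]reprK -[y in LHS]reprK.
rewrite -[_ * _]/(presented_class _ (qrepr x) * presented_class _ (qrepr y)).
by rewrite -presented_classM strand_class strand_word_cat.
Qed.

Lemma endpointM x y p : endpoint (x * y) p = endpoint y (endpoint x p).
Proof. by rewrite {1}/endpoint strandM. Qed.

(** A crossed product rule, which makes [forget p] multiplicative on the stabilizer of [p]; its
    fixed points and its kernel there are therefore subgroups. *)
Lemma forgetM x y p : forget p (x * y) = forget p x * forget (endpoint x p) y.
Proof. by rewrite {1}/forget strandM. Qed.

Lemma endpoint1 p : endpoint 1 p = p.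
Proof. by rewrite /endpoint strand_class. Qed.

Lemma forget1 p : forget p 1 = 1.
Proof. by rewrite /forget strand_class. Qed.

Lemma endpointK x : cancel (endpoint x) (endpoint x^-1).
Proof. by move=> p; rewrite -endpointM mulgV endpoint1. Qed.

Lemma forgetV x p : forget p x^-1 = (forget (endpoint x^-1 p) x)^-1.
Proof.
by apply: (mulIg (forget (endpoint x^-1 p) x)); rewrite -forgetM !mulVg forget1.
Qed.

Lemma strand_sigma k p : (0 < k < m)%N ->
  strand_word (qrepr (s k)) p = (swap k p, sigma_forget k p).
Proof.
move=> km; pose i : braid_gen m := exist _ k km.
by rewrite -[k in s k]/(val i) sigma_gen strand_class /= mulg1.
Qed.

Lemma endpoint_sigma k p : (0 < k < m)%N -> endpoint (s k) p = swap k p.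
Proof. by move=> km; rewrite /endpoint strand_sigma. Qed.

Lemma forget_sigma k p : (0 < k < m)%N -> forget p (s k) = sigma_forget k p.
Proof. by move=> km; rewrite /forget strand_sigma. Qed.

Lemma endpoint_sigma_down i j : (i < j <= m)%N -> endpoint (D i j) j = i.+1.
Proof.
move=> /andP[]; elim: j => // j IHj ij jm.
have [ji|ij'] := eqVneq i j; first by rewrite ji sigma_down_id // endpoint1.
rewrite sigma_downS ?endpointM ?endpoint_sigma; try lia.
by rewrite /swap eqxx ifN ?IHj; lia.
Qed.

Lemma is_subgroup_stab p : is_subgroup [set x | endpoint x p = p].
Proof.
split=> [|x y /= xp yp|x /= xp] /=; first exact: endpoint1.
  by rewrite endpointM xp.
by rewrite -{1}xp endpointK.
Qed.

Lemma is_subgroup_forget_id p :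
  is_subgroup [set x | endpoint x p = p /\ forget p x = x].
Proof.
have [s1 sM sV] := is_subgroup_stab p.
split=> [|x y /= [xp fx] [yp fy]|x /= [xp fx]] /=.
- by rewrite endpoint1 forget1.
- by split; [apply: sM | rewrite forgetM xp fx fy].
- by have xVp := sV _ xp; split=> //; rewrite forgetV xVp fx.
Qed.

Lemma is_subgroup_forget_ker p :
  is_subgroup [set x | endpoint x p = p /\ forget p x = 1].
Proof.
have [s1 sM sV] := is_subgroup_stab p.
split=> [|x y /= [xp fx] [yp fy]|x /= [xp fx]] /=.
- by rewrite endpoint1 forget1.
- by split; [apply: sM | rewrite forgetM xp fx fy mulg1].
- by have xVp := sV _ xp; split=> //; rewrite forgetV xVp fx invg1.
Qed.

Lemma endpoint_pure_gen i j p : (0 < i < j)%N -> (j <= m)%N ->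
  endpoint (a i j) p = p.
Proof.
move=> ij jm; rewrite /pure_gen expgS expg1 !endpointM !endpoint_sigma; try lia.
by rewrite swapK endpointK.
Qed.

Lemma forget_id_sigma k p : (p < k)%N -> (0 < k < m)%N ->
  endpoint (s k) p = p /\ forget p (s k) = s k.
Proof.
move=> pk km; rewrite endpoint_sigma // forget_sigma // /swap /sigma_forget.
by case_ifs.
Qed.

Lemma forget_id_sigma_down i j p : (p <= i)%N -> (i < j <= m)%N ->
  endpoint (D i j) p = p /\ forget p (D i j) = D i j.
Proof.
move=> pi /andP[]; have [S1 SM SV] := is_subgroup_forget_id p.
elim: j => // j IHj ij jm.
have [->|ij'] := eqVneq i j; first by rewrite sigma_down_id //.
rewrite sigma_downS; last by lia.
by apply: SM; [apply: forget_id_sigma; lia | apply: IHj; lia].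
Qed.

Lemma forget_id_pure_gen p i j : (p < i < j)%N -> (j <= m)%N ->
  endpoint (a i j) p = p /\ forget p (a i j) = a i j.
Proof.
move=> pij jm; have [S1 SM SV] := is_subgroup_forget_id p.
have sD : endpoint (D i j) p = p /\ forget p (D i j) = D i j.
  by apply: forget_id_sigma_down; lia.
have ss : endpoint (s i) p = p /\ forget p (s i) = s i.
  by apply: forget_id_sigma; lia.
by apply: (SM) (SV _ sD); apply: (SM) => //; apply: (SM).
Qed.

(** The strand starting at [i] avoids the crossings of [D i j] and takes part in both crossings of
    $\sigma_i^2$, so only [D i j] times its inverse is left. *)
Lemma forget_pure_gen i j : (0 < i < j)%N -> (j <= m)%N ->
  forget i (a i j) = 1.
Proof.
move=> ij jm; have [Di fD] : endpoint (D i j) i = i /\ forget i (D i j) = D i j.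
  by apply: forget_id_sigma_down; lia.
have [s2i fs2] : endpoint (s i ^+ 2) i = i /\ forget i (s i ^+ 2) = 1.
  rewrite expgS expg1 endpointM forgetM !endpoint_sigma ?forget_sigma; try lia.
  by rewrite swapK /swap /sigma_forget eqxx; case_ifs; rewrite mulg1.
have DVi : endpoint (D i j)^-1 i = i.
  by rewrite -[X in endpoint _ X]Di endpointK.
(* The square is generalized so that the product rules treat it as one factor. *)
rewrite /pure_gen; move: (s i ^+ 2) s2i fs2 => z s2i fs2.
by rewrite !(forgetM, endpointM) Di s2i fs2 fD forgetV DVi fD mulg1 mulgV.
Qed.

End Strands.

(** * Conjugation of the $a_{ij}$ by the generators $\sigma_k$ *)

Section Conjugation.
Variable m : nat.
Notation s := (sigma m).
Notation a := (pure_gen m).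
Notation D := (sigma_down m).

Lemma sigma_down_commute_low i j k : (k < i)%N -> commute (s k) (D i j).
Proof.
move=> ki; elim: j => [|j IHj].
  by rewrite sigma_down_id //; apply: commute1.
have [ij|ji] := ltnP i j; last by rewrite sigma_down_id //; apply: commute1.
by rewrite sigma_downS //; apply: commuteM => //; apply: sigma_far; lia.
Qed.

Lemma sigma_down_commute_high i j k : (j < k)%N -> commute (s k) (D i j).
Proof.
move=> jk; elim: j jk => [|j IHj] jk.
  by rewrite sigma_down_id //; apply: commute1.
have [ij|ji] := ltnP i j; last by rewrite sigma_down_id //; apply: commute1.
rewrite sigma_downS //; apply: commuteM; last by apply: IHj; lia.
by apply: commute_sym; apply: sigma_far; lia.
Qed.

(** The braid relation applies where $\sigma_{k+1}\sigma_k$ occurs in [D i j]; $\sigma_k$ commutes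
    with the factors before it, and the resulting $\sigma_{k+1}$ with those after it. *)
Lemma sigma_sigma_down i j k : (i < k)%N -> (k.+1 < j <= m)%N ->
  s k * D i j = D i j * s k.+1.
Proof.
move=> ik /andP[]; elim: j => // j IHj kj jm.
rewrite (@sigma_downS m i j); last by lia.
have [kj1|kj1] := eqVneq k.+1 j; last first.
  by rewrite mulgA sigma_far -?mulgA ?IHj //; lia.
rewrite -kj1 sigma_downS // (mulgA (s k.+1)) mulgA sigma_braid; try lia.
by rewrite -!mulgA; congr (_ * (_ * _)); apply: sigma_down_commute_high.
Qed.

(** Conjugation by [D i j] takes $\sigma_{k+1}$, which commutes with $\sigma_i^2$, to $\sigma_k$. *)
Lemma sigma_pure_mid i j k : (i < k)%N -> (k.+1 < j <= m)%N ->
  commute (s k) (a i j).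
Proof.
move=> ik kj; have c : commute (s k.+1) (s i ^+ 2).
  by apply/commuteX/commute_sym/sigma_far.
have -> : s k = D i j * s k.+1 * (D i j)^-1.
  by rewrite -sigma_sigma_down // mulgK.
rewrite /pure_gen; move: (s i ^+ 2) c => z c.
by rewrite /commute -!mulgA !mulKg; congr (_ * _); rewrite !mulgA c.
Qed.

Lemma sigma_pure_low i j k : (k.+1 < i)%N -> commute (s k) (a i j).
Proof.
move=> ki; have c : commute (s k) (D i j) by apply: sigma_down_commute_low; lia.
apply: commuteM; last exact: commuteV.
by apply: commuteM => //; apply/commuteX/sigma_far.
Qed.

(** Conjugation by $\sigma_i\sigma_{i+1}$ takes $\sigma_i^2$ to $\sigma_{i+1}^2$, and $\sigma_i$
    commutes with what remains of [D i j] once its last factor $\sigma_{i+1}$ is split off. *)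
Lemma sigma_pure_shift i j : (0 < i)%N -> (i.+1 < j <= m)%N ->
  s i * a i j * (s i)^-1 = a i.+1 j.
Proof.
move=> i0 ij; have c : commute (s i) (D i.+1 j).
  by apply: sigma_down_commute_low.
have E : s i * (s i.+1 * (s i * s i)) = s i.+1 * (s i.+1 * (s i * s i.+1)).
  have br : s i * (s i.+1 * s i) = s i.+1 * (s i * s i.+1).
    by apply: sigma_braid; lia.
  by rewrite -br !mulgA; congr (_ * _); rewrite -!mulgA.
have F : s i * (s i.+1 * s i ^+ 2 * (s i.+1)^-1) * (s i)^-1 = s i.+1 ^+ 2.
  rewrite !expgS !expg0 !mulg1 !mulgA; do 2![apply: (canLR (mulgK _))].
  by rewrite -!mulgA E.
rewrite /pure_gen sigma_down_last; last by lia.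
rewrite -F; move: (s i ^+ 2) => x.
by rewrite invgM !mulgA c -!mulgA -!invgM c.
Qed.

(** Where $\sigma_j$ lowers an index instead of raising it, two factors $\sigma_j$ combine into the
    pure braid $\sigma_j^2 = a_{j,j+1}$. *)
Lemma pure_gen_far_conj i j : (i < j)%N ->
  s j * a i j.+1 * (s j)^-1 = a j j.+1 * a i j * (a j j.+1)^-1.
Proof.
move=> ij; rewrite pure_genS // pure_gen_base.
by rewrite !expgS !expg0 !mulg1 invgM !mulgA.
Qed.

Lemma pure_gen_near_conj i j : (0 < i)%N -> (i.+1 < j <= m)%N ->
  s i * a i.+1 j * (s i)^-1 = a i i.+1 * a i j * (a i i.+1)^-1.
Proof.
move=> i0 ij; rewrite -sigma_pure_shift // pure_gen_base.
by rewrite !expgS !expg0 !mulg1 invgM !mulgA.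
Qed.

End Conjugation.

(** * The groups $H_i$, written [V_from i], and their splittings *)

Section PureHandlebody.
Variables g n : nat.
Local Notation m := (g + n)%N.
Notation s := (sigma m).
Notation a := (pure_gen m).
Notation D := (sigma_down m).

Definition V_from (i : nat) : set (braid m) :=
  gen_subgroup
    (\bigcup_(k in [set k | i <= k <= g]%N) V g n k `|` Pn_tilde g n).

Lemma V_fromP i : is_subgroup (V_from i).
Proof. exact: gen_subgroupP. Qed.

Lemma V_from_gen i k j : (i <= k < j)%N -> (g < j <= m)%N -> V_from i (a k j).
Proof.
move=> ikj gjm; apply: sub_gen_subgroup; have [kg|gk] := leqP k g.
  left; exists k => /=; first by lia.
  by apply: sub_gen_subgroup; exists j.
by right; apply: sub_gen_subgroup; exists (k, j) => //=; lia.
Qed.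

(** The bound on [i] puts the generators of [Pn_tilde], whose first index exceeds [g], in the range
    [i <= k]. *)
Lemma V_from_sub i (S : set (braid m)) : (i <= g.+1)%N -> is_subgroup S ->
    (forall k j, (i <= k < j)%N -> (g < j <= m)%N -> S (a k j)) ->
  V_from i `<=` S.
Proof.
move=> ig gS Sa; apply: gen_subgroup_sub => // x [[k /= ik]|];
  apply: gen_subgroup_sub => //.
  by move=> _ [j /= gj <-]; apply: Sa; lia.
by move=> _ [[k j] /= kj <-]; apply: Sa; lia.
Qed.

Lemma V_from_last : V_from g.+1 = Pn_tilde g n.
Proof.
apply/seteqP; split; last first.
  by apply: subset_trans (@sub_gen_subgroup _ _) => x; right.
apply: V_from_sub => //; first exact: gen_subgroupP.
by move=> k j kj gj; apply: sub_gen_subgroup; exists (k, j) => //=; lia.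
Qed.

Lemma V_fromS i : (i <= g)%N -> V_from i.+1 `<=` V_from i.
Proof.
move=> ig; apply: V_from_sub => //; first exact: V_fromP.
by move=> k j kj gj; apply: V_from_gen => //; lia.
Qed.

Lemma V_from_pure i p x : (0 < i <= g.+1)%N -> V_from i x -> endpoint x p = p.
Proof.
move=> ig; apply: (V_from_sub (S := [set x | endpoint x p = p])) x.
- by lia.
- exact: is_subgroup_stab.
- by move=> k j kj gj; apply: endpoint_pure_gen; lia.
Qed.

(** Every braid of [V_from i] fixes position [i], so [forget i] is a homomorphism there; its kernel
    [K] is normal and contains the generators of [V g n i]. *)
Lemma V_bar_forget i x : (0 < i <= g)%N -> V_bar g n i x -> forget i x = 1.
Proof.
move=> ig; have [H1 HM HV] := V_fromP i.
have Hi y : V_from i y -> endpoint y i = i by apply: V_from_pure; lia.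
have [K1 KM KV] := is_subgroup_forget_ker m i.
pose K := [set y | V_from i y /\ (endpoint y i = i /\ forget i y = 1)].
have gK : is_subgroup K.
  split=> [//|y z [Hy Ky] [Hz Kz]|y [Hy Ky]].
    by split; [exact: HM | exact: (KM _ _ Ky Kz)].
  by split; [exact: HV | exact: (KV _ Ky)].
suff /(_ x) VK : V_bar g n i `<=` K by case/VK=> _ [].
apply: normal_closure_sub; first split=> // [y []//|y b [Hy [_ fy]] Hb].
  split; first exact: HM (HM _ _ Hb Hy) (HV _ Hb).
  have HbV := HV _ Hb.
  by rewrite !(endpointM, forgetM) !Hi // fy forgetV Hi // mulg1 mulgV.
apply: gen_subgroup_sub => // _ [j /= gj <-].
split; first by apply: V_from_gen => //; lia.
by split; [apply: endpoint_pure_gen; lia | apply: forget_pure_gen; lia].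
Qed.

Lemma V_from_forget i x : (i <= g)%N -> V_from i.+1 x -> forget i x = x.
Proof.
move=> ig; suff /(_ x) h : V_from i.+1 `<=`
    [set x | endpoint x i = i /\ forget i x = x] by case/h.
apply: V_from_sub => //; first exact: is_subgroup_forget_id.
by move=> k j kj gj; apply: forget_id_pure_gen; lia.
Qed.

Lemma V_bar_sdprod i : (0 < i <= g)%N ->
  is_sdprod (V_bar g n i) (V_from i.+1) (V_from i).
Proof.
move=> ig; apply: is_sdprod_gen.
- apply: normal_closureP; first exact: gen_subgroupP.
  apply: subset_trans (@sub_gen_subgroup _ _) => x Vx; left; exists i => //=.
  by lia.
- exact: V_fromP.
- exact: V_fromP.
- by apply: V_fromS; lia.
- apply: V_from_sub; [by lia | exact: gen_subgroupP | move=> k j ikj gj].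
  apply: sub_gen_subgroup; have [->|ik] := eqVneq k i; [left|right].
    by apply: sub_normal_closure; apply: sub_gen_subgroup; exists j.
  by apply: V_from_gen => //; lia.
- move=> x [/(V_bar_forget ig) fx Hx].
  by rewrite -fx (V_from_forget _ Hx) //; lia.
Qed.

(** * Stability of $H_1$ under conjugation *)

Notation N := (V_from 1).

(** According to the place of [k] relative to [i] and [j], $a_{ij}$ is fixed, has one index raised,
    or becomes a conjugate of one generator of [N] by another. As [g < k], second indices stay above
    [g]. *)
Lemma V_from_conj_sigma k : (g < k < m)%N ->
  forall x, N x -> N (s k * x * (s k)^-1).
Proof.
move=> gk; have [N1 NM NV] := V_fromP 1.
have Na i j : (0 < i < j)%N -> (g < j <= m)%N -> N (a i j) by apply: V_from_gen.
have NJ x y : N x -> N y -> N (x * y * x^-1) 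
    by move=> Nx Ny; exact: NM (NM _ _ Nx Ny) (NV _ Nx).
have fix_conj x : commute (s k) x -> s k * x * (s k)^-1 = x.
  by move=> ->; rewrite mulgK.
apply: (V_from_sub _ (is_subgroup_conj (s k) (V_fromP 1))) => [|i j ij gj] //=.
have [jk|kj] := ltnP j k.
  rewrite fix_conj; first by apply: Na; lia.
  by apply/commute_sym/sigma_pure_far; lia.
have [kj'|jk] := eqVneq k j.
  by rewrite kj' -pure_genS; [apply: Na; lia | lia].
have [ki|ik] := ltnP k.+1 i.
  by rewrite fix_conj; [apply: Na | apply: sigma_pure_low].
have [ik1|ik1] := eqVneq i k.+1.
  rewrite ik1 pure_gen_near_conj; try lia.
  by apply: NJ; apply: Na; lia.
have [jk1|jk1] := eqVneq j k.+1.
  have [ik'|ik'] := eqVneq i k.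
    rewrite ik' jk1 fix_conj; first by apply: Na; lia.
    by rewrite pure_gen_base; apply: commuteX.
  rewrite jk1 pure_gen_far_conj; last by lia.
  by apply: NJ; apply: Na; lia.
have [ik'|ik'] := eqVneq i k.
  by rewrite ik' sigma_pure_shift; [apply: Na; lia | lia | lia].
by rewrite fix_conj; [apply: Na | apply: sigma_pure_mid; lia].
Qed.

Lemma V_from_sigma2 k : (g < k < m)%N -> N (s k * s k).
Proof.
move=> gk; have : N (a k k.+1) by apply: V_from_gen; lia.
by rewrite pure_gen_base expgS expg1.
Qed.

Lemma V_from_conj_sigma_down i j : (g <= i)%N -> (i < j <= m)%N ->
  forall x, N x -> N (D i j * x * (D i j)^-1).
Proof.
move=> gi /andP[]; elim: j => // j IHj ij jm x Nx.
have [ji|ij'] := eqVneq i j.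
  by rewrite ji sigma_down_id // mul1g invg1 mulg1.
rewrite sigma_downS; last by lia.
have -> : s j * D i j * x * (s j * D i j)^-1 =
  s j * (D i j * x * (D i j)^-1) * (s j)^-1 by rewrite invgM !mulgA.
by apply: V_from_conj_sigma; [lia | apply: IHj => //; lia].
Qed.

(** * Coset representatives for the permutations of the last $n$ positions *)

Definition below (t : nat) : set (braid m) :=
  gen_subgroup (N `|` [set s k | k in [set k | g < k < t]%N]).

Lemma belowP t : is_subgroup (below t).
Proof. exact: gen_subgroupP. Qed.

Lemma below_N t : N `<=` below t.
Proof. by move=> x Nx; apply: sub_gen_subgroup; left. Qed.

Lemma below_sigma t k : (g < k < t)%N -> below t (s k).
Proof. by move=> kt; apply: sub_gen_subgroup; right; exists k. Qed.

(* The elements of below t fix position t+1 and sigma_down i t.+1 moves it to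
   i+1: on permutations, these are coset representatives of S_{t-g} in
   S_{t+1-g}. *)
Lemma below_coset t : (g <= t < m)%N ->
  below t.+1 `<=` [set x | exists y i,
    [/\ below t y, (g <= i <= t)%N & x = y * D i t.+1]].
Proof.
move=> gt; have [K1 KM KV] := belowP t.
have [N1 NM NV] := V_fromP 1.
set P := (P in _ `<=` P).
have PN x y : P x -> N y -> P (x * y).
  move=> [z [i [Kz gi ->]]] Ny.
  exists (z * (D i t.+1 * y * (D i t.+1)^-1)), i; split=> //.
    apply: KM => //; apply: below_N; apply: V_from_conj_sigma_down => //; lia.
  by rewrite !mulgA mulgKV.
(* If [k < i], the letter passes through [D i t.+1]; if [k = i], it lengthens it; if [k = i.+1], it
   squares the last factor, which splits off [a i.+1 t.+1] on the left; otherwise it emerges on the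
   left as [s k.-1]. *)
have Ps x k : (g < k < t.+1)%N -> P x -> P (x * s k).
  move=> gk [y [i [Ky gi ->]]]; have [ki|ik] := ltnP k i.
    exists (y * s k), i; split=> //.
      by apply: (KM) => //; apply: below_sigma; lia.
    by rewrite -!mulgA sigma_down_commute_low.
  have [ki|ki] := eqVneq k i.
    exists y, i.-1; split=> //; first by lia.
    rewrite (@sigma_down_last _ i.-1); last by lia.
    by rewrite ki prednK ?mulgA //; lia.
  have [ki1|ki1] := eqVneq k i.+1.
    exists (y * a i.+1 t.+1), i.+1; split; [|lia|].
      by apply: (KM) => //; apply: below_N; apply: V_from_gen; lia.
    rewrite ki1 sigma_down_last; last by lia.
    by rewrite /pure_gen expgS expg1 !mulgA mulgKV.
  exists (y * s k.-1), i; split=> //.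
    by apply: (KM) => //; apply: below_sigma; lia.
  by rewrite -!mulgA sigma_sigma_down ?prednK //; lia.
apply: gen_subgroup_ind => [|x y Px [Ny|[k /= gk <-]]].
- exists 1, t; split=> //; first by lia.
  by rewrite sigma_down_id // mulg1.
- by split; apply: PN => //; exact: NV.
- split; first exact: Ps.
  (* Inverse letters reduce to positive ones because $\sigma_k^2$ lies in [N]. *)
  have -> : x * (s k)^-1 = x * (s k * s k)^-1 * s k.
    by rewrite invgM !mulgA mulgKV.
  by apply: Ps => //; apply: PN => //; apply: (NV); apply: V_from_sigma2; lia.
Qed.

Lemma below_stab t p x :
  (t < p)%N -> (t <= m)%N -> below t x -> endpoint x p = p.
Proof.
move=> tp tm; apply: (gen_subgroup_sub (B := [set x | endpoint x p = p])) x.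
  exact: is_subgroup_stab.
move=> x [Nx|[k /= gk <-]]; first by apply: V_from_pure Nx; lia.
by rewrite endpoint_sigma /swap; [case_ifs | lia].
Qed.

Lemma below_pure t x : (t <= m)%N -> below t x ->
  (forall p, (g < p <= m)%N -> endpoint x p = p) -> N x.
Proof.
(* No [k] satisfies [g < k < r] here, so [below r] has no generators outside [N]. *)
have base r : (r <= g.+1)%N -> below r `<=` N.
  move=> rg; apply: gen_subgroup_sub; first exact: V_fromP.
  by move=> y [//|[k /= gk _]]; lia.
elim: t x => [|t IHt] x tm Kx xp; first exact: base Kx.
have [tg|gt] := leqP t g; first by apply: base Kx; lia.
have gt2 : (g <= t < m)%N by lia.
have [y [i [Ky gi xE]]] := below_coset gt2 Kx.
have it : i = t.
  have := xp t.+1; rewrite xE endpointM (below_stab _ _ Ky); try lia.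
  by rewrite endpoint_sigma_down; lia.
have xy : x = y by rewrite xE it sigma_down_id // mulg1.
by apply: IHt (ltnW tm) _ xp; rewrite xy.
Qed.

(** * The image of the kernel of $\psi_n$ *)

Local Notation hb := (@hbraid_to_braid g n).
Local Notation P := (Pgn g n).

Lemma hbraid_to_braidM x y : hb (x * y) = hb x * hb y.
Proof. by rewrite /hbraid_to_braid gmulfM. Qed.

Lemma hbraid_to_braid1 : hb 1 = 1.
Proof. by rewrite /hbraid_to_braid gmulf1. Qed.

Lemma hbraid_to_braidV x : hb x^-1 = (hb x)^-1.
Proof. by rewrite /hbraid_to_braid gmulfV. Qed.

Lemma psiM x y : @psi g n (x * y) = psi x * psi y.
Proof. by rewrite /psi gmulfM. Qed.

Lemma psi1 : @psi g n 1 = 1.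
Proof. by rewrite /psi gmulf1. Qed.

Lemma psiV x : @psi g n x^-1 = (psi x)^-1.
Proof. by rewrite /psi gmulfV. Qed.

Lemma is_subgroup_Pgn : is_subgroup P.
Proof.
split=> [|_ _ [x px <-] [y py <-]|_ [x px <-]].
- by exists 1; rewrite ?hbraid_to_braid1 //; apply: psi1.
- exists (x * y); last exact: hbraid_to_braidM.
  by rewrite /hpure /= psiM px py mulg1.
- by exists x^-1; [rewrite /hpure /= psiV px invg1 | apply: hbraid_to_braidV].
Qed.

Lemma Pgn_conj_sigma k x : (g < k < m)%N -> P x -> P (s k * x * (s k)^-1).
Proof.
move=> gk [y py <-]; pose i : {i : nat | g < i < g + n}%N := exist _ k gk.
pose z := presented_gen (@hbraid_rel g n) (inr i).
exists (z * y * z^-1); first by rewrite /hpure /= !psiM psiV py mulg1 mulgV.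
by rewrite !hbraid_to_braidM hbraid_to_braidV hbraid_to_braid_sigma.
Qed.

(** The sources are $\tau_i$ for $a_{i,g+1}$ and $\sigma_i^2$ for $a_{i,i+1}$ with $i > g$;
    conjugation by $\sigma_j$ then raises the second index. *)
Lemma Pgn_pure_gen i j : (0 < i < j)%N -> (g < j <= m)%N -> P (a i j).
Proof.
elim: j => // j IHj ij gj.
have [jg|jg] := eqVneq j g.
  have ig : (0 < i <= g)%N by lia.
  pose k : {k : nat | 0 < k <= g}%N := exist _ i ig.
  exists (presented_gen _ (inl k)); first exact: psi_tau.
  by rewrite hbraid_to_braid_tau jg.
have [->|ij'] := eqVneq i j; last first.
  by rewrite pure_genS; [apply: Pgn_conj_sigma; [lia | apply: IHj; lia] | lia].
have gj' : (g < j < m)%N by lia.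
pose k : {k : nat | g < k < g + n}%N := exist _ j gj'.
exists (presented_gen _ (inr k) ^+ 2).
  by rewrite /hpure /= expgS expg1 psiM !psi_sigma tperm2.
rewrite pure_gen_base !expgS !expg0 !mulg1.
by rewrite hbraid_to_braidM hbraid_to_braid_sigma.
Qed.

(** This ties the strand positions to [psi], where the ordinal [p] encodes position [p + g.+1]. Both
    [endpointM] and [permM] apply the left factor first, so a check on generators suffices. *)
Lemma below_hbraid x : (0 < n)%N -> below m (hb x) /\
  (forall p : 'I_n, endpoint (hb x) (p + g.+1) = psi x p + g.+1)%N.
Proof.
move=> n0; have [K1 KM KV] := belowP m.
have gen (y : hbraid_gen g n) : below m (hbraid_to_braid_gen y) /\
  (forall p : 'I_n, endpoint (hbraid_to_braid_gen y) (p + g.+1) =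
                    psi_gen y p + g.+1)%N.
  case: y => [[k kg]|[k gk]] /=; split.
  - by apply: below_N; apply: V_from_gen; lia.
  - by move=> p; rewrite perm1 endpoint_pure_gen //; lia.
  - exact: below_sigma.
  - move=> p; rewrite endpoint_sigma /swap; last by lia.
    case: tpermP => [->|->|/eqP plo /eqP phi] /=; [by case_ifs | by case_ifs |].
    by rewrite -!val_eqE /= in plo phi; case_ifs.
have [u ->] : exists u, x = presented_class _ u.
  by exists (qrepr x); rewrite /presented_class reprK.
rewrite /hbraid_to_braid /psi !presented_lift_class.
elim: u => [|[y b] u [Ku eu]].
  by rewrite /eval_word !big_nil; split=> // p; rewrite endpoint1 perm1.
have [Ky ey] := gen y; rewrite /eval_word !big_cons -!/(eval_word _ u); split.
  by apply: (KM) => //; case: b => //; apply: KV.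
move=> p; rewrite endpointM permM -eu; congr endpoint; case: b => //=.
(* For an inverse letter, [p] is written as the image of its preimage, to which [ey] applies. *)
by rewrite -[in LHS](permKV (psi_gen y) p) -ey endpointK.
Qed.

Lemma Pgn_V_from : (0 < n)%N -> V_from 1 = P.
Proof.
move=> n0; apply/seteqP; split.
  apply: V_from_sub => //; first exact: is_subgroup_Pgn.
  by move=> k j kj gj; apply: Pgn_pure_gen; lia.
move=> _ [x px <-]; have [Kx ex] := below_hbraid x n0.
apply: (below_pure _ Kx) => [//|p gp].
have hp : (p - g.+1 < n)%N by lia.
by have := ex (Ordinal hp); rewrite px perm1 /= subnK; lia.
Qed.

(** The constraint on [i + k] makes the empty list correspond to [V_from g.+1], that is, to
    [Pn_tilde g n]. *)
Lemma iter_sdprod_V_bar i k : (0 < i)%N -> (i + k)%N = g.+1 ->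
  is_iter_sdprod [seq V_bar g n j | j <- iota i k] (Pn_tilde g n) (V_from i).
Proof.
elim: k i => [|k IHk] i i0 ik /=.
  split; first exact: gen_subgroupP.
  by rewrite -V_from_last; congr V_from; lia.
exists (V_from i.+1); first by apply: IHk => //; lia.
by apply: V_bar_sdprod; lia.
Qed.

End PureHandlebody.

Theorem theorem1 (g n : nat) (g_ge1 : (1 <= g)%N) (n_ge1 : (1 <= n)%N) :
  is_iter_sdprod [seq V_bar g n i | i <- iota 1 g] (Pn_tilde g n) (Pgn g n).
Proof. by rewrite -Pgn_V_from //; apply: iter_sdprod_V_bar. Qed.
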